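(* Let $p\ge1$ be an integer, let $\lambda>0$ be a real number, and let $G$ be a connected graph belonging to $\mathbf{W}_p$, with $n=n(G)$ and $\alpha=\alpha(G)$. Suppose that $G$ is $\lambda$-quasi-regularizable. If $$(k+1)\,p\,(\alpha-k+1)-k\bigl(n-(\lambda+1)k\bigr)\ge0$$ for every integer $k$ with $1\le k\le\alpha-1$, then the independence polynomial $I(G;x)$ is log-concave.
   Context: All graphs are finite, undirected and simple. $V(G)$ is the vertex set, $n(G)=|V(G)|$, and $\alpha(G)$ is the maximum cardinality of an independent set of $G$. A maximum independent set is an independent set of cardinality $\alpha(G)$. The empty set is an independent set. For $A\subseteq V(G)$ the open neighborhood is $N_G(A)=\{v\in V(G)\setminus A : uv\in E(G)\text{ for some }u\in A\}$. For an integer $p\ge1$, a graph $G$ belongs to $\mathbf{W}_p$ if $n(G)\ge p$ and, for every $p$ pairwise disjoint independent sets $A_1,\ldots,A_p$ of $G$ (possibly empty), there exist $p$ pairwise disjoint maximum independent sets $S_1,\ldots,S_p$ of $G$ such that $A_i\subseteq S_i$ for every $i$. For a real number $\lambda>0$, a graph $G$ is $\lambda$-quasi-regularizable if $\lambda|A|\le|N_G(A)|$ for every independent set $A$ of $G$. The independence polynomial of $G$ is $I(G;x)=\sum_{k=0}^{\alpha(G)}s_kx^k$, where $s_k$ is the number of independent sets of $G$ of cardinality $k$. It is log-concave if $s_k^2\ge s_{k-1}s_{k+1}$ for all $1\le k\le\alpha(G)-1$. *)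

(* Defs.v *)
From mathcomp Require Import all_boot all_order all_algebra.
From mathcomp Require Import reals.

Set Implicit Arguments.
Unset Strict Implicit.
Unset Printing Implicit Defensive.

Import Order.TTheory GRing.Theory Num.Theory.

Record sgraph := SGraph {
  vertex :> finType;
  edge : rel vertex;
  edge_sym : symmetric edge;
  edge_irrefl : irreflexive edge
}.

Section Graph.

Variable G : sgraph.
Implicit Types A S : {set G}.

(* The empty graph is connected under this definition. *)
Definition connected_graph : Prop :=
  forall x y : G, connect (@edge G) x y.

Definition independent A : bool :=
  [forall x in A, forall y in A, ~~ edge x y].

Definition alpha : nat := \max_(A : {set G} | independent A) #|A|.

Definition max_independent S : bool := independent S && (#|S| == alpha).

Definition open_nbhd A : {set G} :=
  [set v | (v \notin A) && [exists u in A, edge u v]].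

Definition pairwise_disjoint (p : nat) (A : 'I_p -> {set G}) : Prop :=
  forall i j : 'I_p, i != j -> [disjoint A i & A j].

Definition in_W (p : nat) : Prop :=
  p <= #|G| /\
  forall A : 'I_p -> {set G},
    (forall i, independent (A i)) -> pairwise_disjoint A ->
    exists S : 'I_p -> {set G},
      [/\ forall i, max_independent (S i),
          pairwise_disjoint S
        & forall i, A i \subset S i].

Definition num_indep (k : nat) : nat :=
  #|[set A : {set G} | independent A & #|A| == k]|.

Definition indep_poly : {poly int} :=
  (\poly_(k < alpha.+1) ((num_indep k)%:R : int))%R.

(* Truncated [alpha - 1] is harmless: the range is empty when [alpha <= 1]. *)
Definition log_concave_indep_poly : Prop :=
  forall k : nat, 1 <= k <= alpha - 1 ->
    (indep_poly`_k.-1 * indep_poly`_k.+1 <= indep_poly`_k ^+ 2)%R.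

Definition quasi_regularizable (R : realType) (lambda : R) : Prop :=
  forall A, independent A ->
    (lambda * #|A|%:R <= #|open_nbhd A|%:R)%R.

End Graph.

(* Main.v *)
Require Import Defs.
From mathcomp Require Import all_boot all_order all_algebra.
From mathcomp Require Import reals ring lra.

Import Order.TTheory GRing.Theory Num.Theory.
Local Open Scope ring_scope.

(** Write [s_k] for the number of independent sets of size [k], and count the
    pairs (independent set, one-vertex independent extension of it).  Deleting
    a vertex from an independent set of size [k + 1] shows that the numbers of
    extensions of the independent sets of size [k] add up to [(k + 1) s_{k+1}]
    ([sum_card_extensions]).  The two hypotheses on [G] bound each of these
    numbers from one side.

    - Above: an extension of [A] avoids both [A] and its neighbourhood, so
      quasi-regularizability leaves at most [n - (lambda + 1) |A|] of them, and
      [(k + 1) s_{k+1} <= (n - (lambda + 1) k) s_k].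
    - Below: in [W_p], any independent [B] is completed to a maximum independent
      set by each of [p] pairwise disjoint sets ([disjoint_completions]).  Each
      of their vertices extends [B], so [p (alpha - |B|)] vertices do, and
      [p (alpha - k + 1) s_{k-1} <= k s_k].

    Multiplying the two bounds, the numerical hypothesis turns
    [(k + 1) p (alpha - k + 1) s_{k-1} s_{k+1} <= k (n - (lambda + 1) k) s_k^2]
    into log-concavity, after division by [(k + 1) p (alpha - k + 1) > 0]. *)

Section Extensions.

Variable G : sgraph.
Implicit Types A B C S : {set G}.

Definition extensions A : {set G} :=
  [set x | (x \notin A) && independent (x |: A)].

Lemma independentS A B : A \subset B -> independent B -> independent A.
Proof.
move=> /subsetP sAB /forall_inP iB; apply/forall_inP => x /sAB xB.
apply/forall_inP => y /sAB yB; exact: (forall_inP (iB x xB)).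
Qed.

Lemma extensions_compl A :
  independent A -> extensions A = ~: (A :|: open_nbhd A).
Proof.
move=> iA; apply/setP => x; rewrite !inE negb_or.
case: (boolP (x \in A)) => //= xA.
apply/idP/idP => [/forall_inP ixA | /exists_inPn nA].
  apply/exists_inPn => u uA.
  by apply: (forall_inP (ixA u _) x); rewrite !inE ?eqxx ?uA ?orbT.
apply/forall_inP => u; rewrite !inE => /orP[/eqP-> | uA];
  apply/forall_inP => v; rewrite !inE => /orP[/eqP-> | vA].
- by rewrite edge_irrefl.
- by rewrite edge_sym nA.
- exact: nA.
- exact: (forall_inP (forall_inP iA u uA)).
Qed.

Lemma card_extensions A :
  independent A -> (#|extensions A| + #|A| + #|open_nbhd A| = #|G|)%N.
Proof.
move=> iA; have dis : [disjoint A & open_nbhd A].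
  by apply/pred0P => x /=; rewrite !inE; case: (x \in A).
rewrite (extensions_compl A iA) -addnA.
have -> : (#|A| + #|open_nbhd A| = #|A :|: open_nbhd A|)%N.
  by apply/esym/eqP; rewrite (leq_card_setU A (open_nbhd A)).2.
by rewrite addnC cardsC.
Qed.

(** For a fixed vertex [x], adding and removing [x] match the independent sets
    of size [k] that [x] extends with those of size [k.+1] that contain [x]. *)
Lemma sum_card_extensions k :
  (\sum_(A : {set G} | independent A && (#|A| == k)) #|extensions A|
     = k.+1 * num_indep G k.+1)%N.
Proof.
transitivity (\sum_(x : G)
    \sum_(C : {set G} | [&& independent C, #|C| == k.+1 & x \in C]) 1)%N.
  rewrite (eq_bigr (fun A => \sum_(x in extensions A) 1)%N) => [|A _];
    last by rewrite sum1_card.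
  rewrite (exchange_big_dep predT) //=; apply: eq_bigr => x _.
  rewrite (reindex_onto (fun C => C :\ x) (fun A => x |: A)) /=; last first.
    by move=> A /andP[_]; rewrite inE => /andP[xA _]; rewrite setU1K.
  apply: eq_bigl => C; rewrite !inE eqxx /=.
  case: (boolP (x \in C)) => xC; last first.
    rewrite !andbF; apply/negbTE; rewrite negb_and; apply/orP; right.
    by apply: contra xC => /eqP <-; rewrite !inE eqxx.
  rewrite setD1K // eqxx andbT (cardsD1 x C) xC add1n eqSS andbT.
  apply/andP/andP => [[/andP[_ ->] ->] //| [iC ->]].
  by rewrite iC (independentS _ _ (subD1set C x) iC).
rewrite (exchange_big_dep (fun C => independent C && (#|C| == k.+1))) /=;
  last by move=> x C _ /and3P[-> ->].
rewrite (eq_bigr (fun=> k.+1)) => [|C /andP[iC /eqP cC]]; last first.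
  rewrite -cC -sum1_card; apply: eq_bigl => x.
  by rewrite iC eqxx.
rewrite sum_nat_const mulnC; congr (_ * _)%N.
by apply: eq_card => C; rewrite inE.
Qed.

Lemma max_completion B S :
  B \subset S -> max_independent S ->
  independent (B :|: (S :\: B)) /\ (#|B| + #|S :\: B| = alpha G)%N.
Proof.
move=> sBS /andP[iS /eqP cS]; split.
  by rewrite -[B in B :|: _](setIidPr sBS) setID.
by rewrite -cS -(cardsID B S) (setIidPr sBS).
Qed.

(** The [p] completions of [B] are found one at a time.  Given disjoint
    completions at the indices below [j], apply the [W_p] property to these
    sets, with [B] itself at index [j]: the maximum independent set obtained
    around [B] avoids the completions already chosen, so removing [B] from it
    gives the next one. *)
Lemma disjoint_completions p B : in_W G p -> independent B ->
  exists C : 'I_p -> {set G},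
    [/\ pairwise_disjoint C, forall i, [disjoint C i & B],
        forall i, independent (B :|: C i)
      & forall i, (#|B| + #|C i| = alpha G)%N].
Proof.
move=> [_ hW] iB.
suff /(_ p (leqnn p)) [C [dC dCB iC cC]] : forall j, (j <= p)%N ->
    exists C : 'I_p -> {set G},
    [/\ pairwise_disjoint C, forall i, [disjoint C i & B],
        forall i, independent (B :|: C i)
      & forall i : 'I_p, (i < j)%N -> (#|B| + #|C i| = alpha G)%N].
  by exists C; split=> // i; apply: cC.
elim=> [_ | j IHj ltjp].
  exists (fun _ => set0); split=> // [i k _ | i | i]; rewrite ?setU0 //.
  - by rewrite -setI_eq0 setI0.
  - by rewrite -setI_eq0 set0I.
have [C [dC dCB iC cC]] := IHj (ltnW ltjp).
pose j0 := Ordinal ltjp.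
have [i||S [mS dS sS]] := hW (fun i => if i == j0 then B else C i).
- by case: eqP => // _; apply: independentS (iC i); apply: subsetUr.
- move=> i k neq_ik; case: eqP => [ij | _]; case: eqP => [kj | _] //.
  + by rewrite ij kj eqxx in neq_ik.
  + by rewrite disjoint_sym.
  + exact: dC.
have sBS : B \subset S j0 by have := sS j0; rewrite eqxx.
have [iD cD] := max_completion B (S j0) sBS (mS j0).
have dCS i : i != j0 -> [disjoint C i & S j0 :\: B].
  move=> ij; apply: disjointWr (subsetDl _ _) _; apply: disjointWl (dS i j0 ij).
  by have := sS i; rewrite (negbTE ij).
exists (fun i => if i == j0 then S j0 :\: B else C i); split.
- move=> i k neq_ik; case: (eqVneq i j0) => [ij | ij];
    case: (eqVneq k j0) => [kj | kj].
  + by rewrite ij kj eqxx in neq_ik.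
  + by rewrite disjoint_sym dCS.
  + exact: dCS.
  + exact: dC.
- move=> i; case: eqP => // _.
  by rewrite -setI_eq0 setIDAC -setIDA setDv setI0.
- by move=> i; case: eqP.
- move=> i; rewrite ltnS => leij; case: (eqVneq i j0) => // ij.
  apply: cC; rewrite ltn_neqAle leij andbT; apply: contraNneq ij => eij.
  exact/eqP/val_inj.
Qed.

Lemma card_extensions_ge p B : in_W G p -> independent B ->
  (p * (alpha G - #|B|) <= #|extensions B|)%N.
Proof.
move=> hW iB; have [C [dC dCB iC cC]] := disjoint_completions p B hW iB.
have sub : \bigcup_i C i \subset extensions B.
  apply/bigcupsP => i _; apply/subsetP => x xC; rewrite inE.
  rewrite (disjointFr (dCB i) xC) /=; apply: independentS (iC i).
  by rewrite subUset subsetUl sub1set inE xC orbT.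
apply: leq_trans (subset_leq_card sub).
rewrite -[leqRHS]sum1_card (partition_disjoint_bigcup _ (fun=> 1%N) dC).
under eq_bigr => i _ do rewrite sum1_card -(addKn #|B| #|C i|) cC.
by rewrite sum_nat_const card_ord.
Qed.

Lemma num_indep_ge p k : in_W G p ->
  (p * (alpha G - k) * num_indep G k <= k.+1 * num_indep G k.+1)%N.
Proof.
move=> hW; rewrite -sum_card_extensions mulnC /num_indep cardsE -sum_nat_const.
apply: leq_sum => A /andP[iA /eqP <-]; exact: card_extensions_ge.
Qed.

Lemma num_indep_le (R : realType) (lambda : R) k :
  quasi_regularizable G lambda ->
  k.+1%:R * (num_indep G k.+1)%:R
    <= (#|G|%:R - (lambda + 1) * k%:R) * (num_indep G k)%:R.
Proof.
move=> hqr; rewrite -natrM -sum_card_extensions natr_sum.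
rewrite /num_indep cardsE mulr_natr -sumr_const.
apply: ler_sum => A /andP[iA /eqP cA].
rewrite -(card_extensions A iA) !natrD cA mulrDl mul1r opprD.
by have := hqr A iA; rewrite cA; lra.
Qed.

End Extensions.

Theorem theorem3p1 (R : realType) (p : nat) (hp : (1 <= p)%N)
    (lambda : R) (hlambda : 0 < lambda)
    (G : sgraph) (hconn : connected_graph G) (hW : in_W G p)
    (hqr : quasi_regularizable G lambda)
    (hineq : forall k : nat, (1 <= k <= alpha G - 1)%N ->
      0 <= (k%:R + 1) * p%:R * ((alpha G)%:R - k%:R + 1)
           - k%:R * (#|G|%:R - (lambda + 1) * k%:R)) :
  log_concave_indep_poly G.
Proof.
move=> k hk; have h := hineq k hk; case: k hk h => // k /= hk h.
have ltk2 : (k.+2 <= alpha G)%N by move: hk; rewrite ltn_subRL add1n.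
rewrite !coef_poly !ltnS (ltnW ltk2) ltk2 (ltnW (ltnW ltk2)).
rewrite -natrM -natrX ler_nat -(ler_nat R) natrM natrX.
have lo : p%:R * ((alpha G)%:R - k%:R) * (num_indep G k)%:R
    <= k.+1%:R * (num_indep G k.+1)%:R :> R.
  have := num_indep_ge G p k hW; rewrite -(ler_nat R) !natrM natrB //.
  exact: ltnW (ltnW ltk2).
have up := num_indep_le G R lambda k.+1 hqr.
have d_gt0 : 0 < (alpha G)%:R - k%:R :> R by rewrite subr_gt0 ltr_nat ltnW.
have c_gt0 : 0 < k.+2%:R * (p%:R * ((alpha G)%:R - k%:R)) :> R.
  by rewrite !mulr_gt0 ?ltr0n.
rewrite -(ler_pM2l c_gt0).
set s0 : R := (num_indep G k)%:R in lo *.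
set s1 : R := (num_indep G k.+1)%:R in lo up *.
set s2 : R := (num_indep G k.+2)%:R in up *.
apply: (@le_trans _ _ ((k.+1%:R * s1)
                       * ((#|G|%:R - (lambda + 1) * k.+1%:R) * s1))).
  rewrite [leLHS](_ : _ = (p%:R * ((alpha G)%:R - k%:R) * s0)
                          * (k.+2%:R * s2)); last by ring.
  by apply: ler_pM => //; rewrite !mulr_ge0 ?ler0n // ltW.
rewrite -subr_ge0.
rewrite (_ : _ - _ = ((k.+1%:R + 1) * p%:R * ((alpha G)%:R - k.+1%:R + 1)
   - k.+1%:R * (#|G|%:R - (lambda + 1) * k.+1%:R)) * s1 ^+ 2); last first.
  by rewrite -(natr1 k.+1) -(natr1 k); ring.
by rewrite mulr_ge0 // sqr_ge0.
Qed.
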